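(* Work in $\mathrm{ZF}^-$. For every $n<\omega$ the limit $$\Pr(S_{\omega,n})=\lim_{m\to\omega}\frac{|S_{\omega,n}\cap V_m|}{|V_m|}$$ exists, and $\Pr(S_{\omega,1})=\Pr(S_{\omega,3})=1/2$, while $\Pr(S_{\omega,n})=0$ for all other $n<\omega$.
   Context: $\mathrm{ZF}^-$ is ZF without the Axiom of Regularity. $V_m$ ($m<\omega$) are the finite levels of the cumulative hierarchy ($V_0=\emptyset$, $V_{m+1}=\mathcal P(V_m)$), $V_\omega=\bigcup_m V_m$. For a set $x$, consider the game: player I chooses $x_0\in x$, then II chooses $x_1\in x_0$, then I chooses $x_2\in x_1$, etc.; a player who cannot move (current set empty) loses. Define by recursion on ordinals $\gamma$: a set is $2\gamma$-winning if each of its elements is $(2\delta+1)$-winning for some $\delta<\gamma$; a set is $(2\gamma+1)$-winning if some element of it is $2\gamma$-winning. Let $W_\nu$ be the class of $\nu$-winning sets, $S_\nu=W_\nu\setminus\bigcup_{\mu<\nu}W_\mu$, and $S_{\alpha,\nu}=V_\alpha\cap S_\nu$. *)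

(* Defs.v *)
From mathcomp Require Import all_boot all_order all_algebra finmap.
From mathcomp Require Import all_classical all_reals all_analysis.

Set Implicit Arguments.
Unset Strict Implicit.
Unset Printing Implicit Defensive.

Import Order.TTheory GRing.Theory Num.Theory numFieldNormedType.Exports.

Local Open Scope classical_set_scope.
Local Open Scope ring_scope.

(* The universe is a type [U] with a membership relation [mem y x] (y is an
   element of x). Classes are subsets of [U], i.e. terms of type [set U]. *)
Section Universe.
Variables (U : Type) (mem : U -> U -> Prop).

Definition elts (x : U) : set U := [set y | mem y x].

(* ZF without Regularity. The two schemas range over all classes and all class
   (partial) functions; with this reading the finite ordinals of the universe
   are exactly the terms of type [nat]. *)
Record ZF_minus : Prop := {
  zf_extensionality : forall x y, (forall z, mem z x <-> mem z y) -> x = y;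
  zf_pairing : forall x y, exists p, forall z, mem z p <-> z = x \/ z = y;
  zf_union : forall x, exists u,
    forall z, mem z u <-> exists2 y, mem y x & mem z y;
  zf_power : forall x, exists p, forall z, mem z p <-> elts z `<=` elts x;
  zf_infinity : exists w,
    (exists2 e, mem e w & forall z, ~ mem z e) /\
    (forall x, mem x w ->
       exists2 s, mem s w & forall z, mem z s <-> mem z x \/ z = x);
  zf_separation : forall (P : set U) a,
    exists b, forall z, mem z b <-> mem z a /\ P z;
  zf_replacement : forall F : U -> U -> Prop,
    (forall x y y', F x y -> F x y' -> y = y') ->
    forall a, exists b, forall y, mem y b <-> exists2 x, mem x a & F x y
}.

Fixpoint V_ (m : nat) : set U :=
  if m is m'.+1 then [set x | elts x `<=` V_ m'] else set0.

Definition V_omega : set U := \bigcup_m V_ m.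

(* The recursion on ordinals, on its finite stages, which are closed under the
   recursion. Every premise has a smaller index than the conclusion, so this
   least solution is the only one: see [winning_evenE] and [winning_oddE]. *)
Inductive winning : nat -> U -> Prop :=
| winning_even (g : nat) (x : U) :
    (forall y, mem y x -> exists2 d, (d < g)%N & winning (2 * d + 1)%N y) ->
    winning (2 * g)%N x
| winning_odd (g : nat) (x : U) :
    (exists2 y, mem y x & winning (2 * g)%N y) ->
    winning (2 * g + 1)%N x.

Lemma winning_evenE g x : winning (2 * g)%N x <->
  forall y, mem y x -> exists2 d, (d < g)%N & winning (2 * d + 1)%N y.
Proof.
split; last exact: winning_even.
move eE: (2 * g)%N => n wx; case: wx eE => [g' {}x wx|g' {}x _].
  by rewrite !mul2n => /double_inj ->.
by move/(congr1 odd); rewrite addn1 /= !mul2n !odd_double.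
Qed.

Lemma winning_oddE g x : winning (2 * g + 1)%N x <->
  exists2 y, mem y x & winning (2 * g)%N y.
Proof.
split; last exact: winning_odd.
move eE: (2 * g + 1)%N => n wx; case: wx eE => [g' {}x _|g' {}x wx].
  by move/(congr1 odd); rewrite addn1 /= !mul2n !odd_double.
by move/addIn; rewrite !mul2n => /double_inj ->; rewrite -mul2n.
Qed.

Definition W_ (n : nat) : set U := [set x | winning n x].

Definition S_ (n : nat) : set U :=
  W_ n `\` \bigcup_(k in [set k | (k < n)%N]) W_ k.

Definition S_omega (n : nat) : set U := V_omega `&` S_ n.

(* [{classic U}] is [U] with its classical choiceType structure. The value is
   the cardinality for finite [A], which covers all subclasses of each [V_ m],
   and is 0 for infinite [A]. *)
Definition card_class (A : set U) : nat :=
  #|` fset_set (A : set {classic U}) |%fset.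

Definition freq (R : realType) (A : set U) (m : nat) : R :=
  (card_class (A `&` V_ m))%:R / (card_class (V_ m))%:R.

Definition Pr (R : realType) (A : set U) : R := limn (freq R A).

End Universe.

(* Main.v *)
Require Import Defs.
From mathcomp Require Import all_boot all_order all_algebra finmap.
From mathcomp Require Import all_classical all_reals all_analysis.
Import Order.TTheory GRing.Theory Num.Theory numFieldNormedType.Exports.
Local Open Scope classical_set_scope.
Local Open Scope ring_scope.

(** A uniformly random element of [V_ m.+1] is a uniformly random subset of
    [V_ m], so it is included in a class [B] with probability [2 ^- N], where
    [N] is the number of elements of [V_ m] outside [B]. The complement of
    [W_ 1], the class [W_ 2] and the complement of [W_ 3] are the classes of
    sets included in the nonempty sets, in [W_ 1] and in the complement of
    [W_ 2] respectively. Hence [W_ 1] has frequency 1/2, while [W_ 2] and the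
    complement of [W_ 3] have frequency tending to 0, since the number of
    elements of [V_ m] outside [W_ 1], respectively in [W_ 2], tends to
    infinity. Up to these two negligible classes, a set outside [W_ 1] belongs
    to [S_ 3]. *)

(** * Counting in finite classes *)

Section CardClass.
Variable U : Type.
Implicit Types A B : set U.

Lemma card_class_le A B : finite_set B -> A `<=` B ->
  (card_class A <= card_class B)%N.
Proof.
move=> fB AB; apply: fsubset_leq_card.
by rewrite -fset_set_sub //; exact: sub_finite_set fB.
Qed.

Lemma card_classU A B : finite_set A -> finite_set B -> A `&` B = set0 ->
  card_class (A `|` B) = (card_class A + card_class B)%N.
Proof.
move=> fA fB AB0; rewrite /card_class (@fset_setU {classic U}) //.
by rewrite cardfsU -(@fset_setI {classic U}) // AB0 fset_set0 cardfs0 subn0.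
Qed.

Lemma card_classID A B : finite_set A ->
  card_class A = (card_class (A `&` B) + card_class (A `\` B))%N.
Proof.
move=> fA; rewrite -card_classU ?setUIDK //.
- by apply: sub_finite_set fA => x [].
- by apply: sub_finite_set fA => x [].
- by apply/seteqP; split=> x // [[_ Bx] [_ nBx]].
Qed.

End CardClass.

Section Winning.
Context {R : realType} {U : Type} {mem : U -> U -> Prop}.
Hypothesis zf : ZF_minus mem.

Local Notation elts := (elts mem).
Local Notation V_ := (V_ mem).
Local Notation W_ := (W_ mem).
Local Notation S_ := (S_ mem).
Local Notation freq := (freq mem R).

(** * Subclasses of the finite levels and their power classes *)

Definition power_class (B : set U) : set U := [set x | elts x `<=` B].

Lemma elts_inj : injective elts.
Proof.
move=> x y exy; apply: (zf_extensionality zf) => z.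
by rewrite -[mem z x]/(elts x z) exy.
Qed.

Lemma empty_exists : exists e, elts e = set0.
Proof.
have [w [[e _ e0] _]] := zf_infinity zf.
by exists e; apply/seteqP; split=> z // /e0.
Qed.

Lemma V_is_set m : exists a, elts a = V_ m.
Proof.
elim: m => [|m [a aE]]; first exact: empty_exists.
have [p pE] := zf_power zf a; exists p.
by apply/seteqP; split=> z /=; rewrite -aE => /pE.
Qed.

Lemma subclass_V_is_set m B : B `<=` V_ m -> exists a, elts a = B.
Proof.
move=> BV; have [a aE] := V_is_set m.
have [b bE] := zf_separation zf B a; exists b.
apply/seteqP; split=> z; first by case/bE.
move=> Bz; apply/bE; split=> //.
by rewrite -[mem z a]/(elts a z) aE; exact: BV.
Qed.

(** Sending a set to the finite set of its elements is injective by extensionality. Its image is the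
    whole finite powerset of [B], because every subclass of [V_ m] is a set, by separation from
    [V_ m]. *)
Lemma power_class_finite_card m B : B `<=` V_ m -> finite_set B ->
  finite_set (power_class B) /\
  card_class (power_class B) = (2 ^ card_class B)%N.
Proof.
move=> BV fB.
pose code (x : {classic U}) : {fset {classic U}} :=
  fset_set (elts x : set {classic U}).
have fin x : elts x `<=` B -> finite_set (elts x).
  by move=> xB; exact: sub_finite_set fB.
have code_inj : {in (power_class B : set {classic U}) &, injective code}.
  move=> x y /set_mem xB /set_mem yB H.
  by apply/elts_inj/(@fset_set_inj {classic U}) => //; exact: fin.
have codeE : code @` power_class B =
    [set` fpowerset (fset_set (B : set {classic U}))].
  apply/seteqP; split=> [_ [x xB <-]|C] /=.
    by rewrite fpowersetE -fset_set_sub //; exact: fin.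
  rewrite fpowersetE => CB.
  have CB' : [set` C] `<=` B.
    by move=> y /= /(fsubsetP CB); rewrite in_fset_set // => /set_mem.
  have [x xE] := subclass_V_is_set _ _ (subset_trans CB' BV).
  by exists x; rewrite /power_class /= /code xE // set_fsetK.
have fP : finite_set (power_class B : set {classic U}).
  rewrite -(eq_finite_set (inj_card_eq code_inj)) codeE.
  exact: finite_fset.
split=> //.
have := congr1 (fun A => #|` fset_set A|%fset) codeE.
rewrite set_fsetK card_fpowerset (@fset_set_image {classic U} _ code) //.
rewrite card_in_imfset //= => x y.
by rewrite !in_fset_set //; exact: code_inj.
Qed.


Lemma V_finite m : finite_set (V_ m).
Proof.
elim: m => [|m IH]; first exact: finite_set0.
by have [] := power_class_finite_card m _ (@subset_refl _ _) IH.
Qed.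

Lemma sub_V_finite m A : A `<=` V_ m -> finite_set A.
Proof. by move=> AV; apply: sub_finite_set (V_finite m). Qed.

Lemma card_V_power_class m B :
  card_class (V_ m.+1 `&` power_class B) = (2 ^ card_class (V_ m `&` B))%N.
Proof.
have -> : V_ m.+1 `&` power_class B = power_class (V_ m `&` B).
  apply/seteqP; split=> x /=.
    by move=> [xV xB] y yx; split; [exact: xV|exact: xB].
  by move=> xVB; split=> y /xVB [].
have BV : V_ m `&` B `<=` V_ m by move=> x [].
by have [] := power_class_finite_card _ _ BV (sub_V_finite _ _ BV).
Qed.

Lemma card_VS m : card_class (V_ m.+1) = (2 ^ card_class (V_ m))%N.
Proof.
by have [] := power_class_finite_card m _ (@subset_refl _ _) (V_finite m).
Qed.

Lemma card_V_ge m : (m <= card_class (V_ m))%N.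
Proof.
elim: m => // m IH; rewrite card_VS.
by apply: leq_trans (ltn_expl _ _).
Qed.

(** * The first winning classes *)

Lemma winning0E : W_ 0 = power_class set0.
Proof.
apply/seteqP; split=> x.
  by move/(winning_evenE mem 0 x) => H y /H [].
by move=> x0; apply/(winning_evenE mem 0 x) => y /x0.
Qed.

Lemma winning2E : W_ 2 = power_class (W_ 1).
Proof.
apply/seteqP; split=> x.
  by move/(winning_evenE mem 1 x) => H y /H [[]].
by move=> xW; apply/(winning_evenE mem 1 x) => y /xW; exists 0%N.
Qed.

Lemma not_winning_oddE g : ~` W_ (2 * g + 1) = power_class (~` W_ (2 * g)).
Proof.
apply/seteqP; split=> x.
  by move=> nW y yx Wy; apply: nW; apply/winning_oddE; exists y.
by move=> xN /winning_oddE [y /xN].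
Qed.

Lemma winning02 : W_ 0 `<=` W_ 2.
Proof. by rewrite winning0E winning2E => x x0 y /x0. Qed.

Lemma winning0_disjoint1 : W_ 0 `&` W_ 1 = set0.
Proof.
apply/seteqP; split=> x // [].
by rewrite winning0E => x0 /(winning_oddE mem 0 x) [y /x0].
Qed.

(** Removing [W_ 0] changes nothing: in an empty set player I has no move to make. *)
Lemma S1E : S_ 1 = W_ 1.
Proof.
apply/seteqP; split=> x; first by case.
move=> W1x; split=> // -[[|//] _ W0x].
have : (W_ 0 `&` W_ 1) x by [].
by rewrite winning0_disjoint1.
Qed.

Lemma S_disjoint n k : n <> k -> S_ n `&` S_ k = set0.
Proof.
move=> nk; apply/seteqP; split=> x // [[Wn nn] [Wk kk]].
case: (ltngtP n k) => // ltnk; first by apply: kk; exists n.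
by apply: nn; exists k.
Qed.

Lemma not_S1_S3_sub : ~` (S_ 1 `|` S_ 3) `<=` W_ 2 `|` ~` W_ 3.
Proof.
move=> x nS; have [W2x|nW2] := pselect (W_ 2 x); first by left.
right=> W3x; apply: nS.
have [W1x|nW1] := pselect (W_ 1 x); first by left; rewrite S1E.
(* Of the indices below 3, 1 and 2 are excluded by [nW1] and [nW2], and 0 reduces to 2. *)
by right; split=> // -[[|[|[|//]]]] _ //= /winning02.
Qed.

(** * Growth of the winning classes along the levels *)

Lemma card_V_winning0 m : card_class (V_ m.+1 `&` W_ 0) = 1%N.
Proof.
by rewrite winning0E card_V_power_class setI0 /card_class fset_set0 cardfs0.
Qed.

Lemma card_V_not_winning0 m : (m <= card_class (V_ m.+1 `\` W_ 0))%N.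
Proof.
have := card_classID _ (V_ m.+1) (W_ 0) (V_finite _).
(* The nonempty sets in [V_ m.+1] number one less than a power of two whose exponent is at least
   [m]. *)
rewrite card_V_winning0 add1n card_VS => E; rewrite -ltnS -E.
exact: leq_ltn_trans (card_V_ge m) (ltn_expl _ _).
Qed.

Lemma card_V_not_winning1 m :
  card_class (V_ m.+1 `\` W_ 1) = (2 ^ card_class (V_ m `\` W_ 0))%N.
Proof. by rewrite !setDE (not_winning_oddE 0) card_V_power_class. Qed.

(** Only the empty set separates [V_ m.+1] from its nonempty members, so [V_ m.+2] has exactly twice
    as many members as lie outside [W_ 1]; the other half lies in [W_ 1]. *)
Lemma card_V_winning1 m :
  card_class (V_ m.+2 `&` W_ 1) = (2 ^ card_class (V_ m.+1 `\` W_ 0))%N.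
Proof.
have := card_classID _ (V_ m.+2) (W_ 1) (V_finite _).
rewrite card_V_not_winning1 card_VS (card_classID _ _ (W_ 0) (V_finite _)).
rewrite card_V_winning0 add1n expnS mul2n -addnn.
by move/addIn.
Qed.

Lemma card_V_not_winning1_ge m : (m <= card_class (V_ m.+2 `\` W_ 1))%N.
Proof.
rewrite card_V_not_winning1; apply: leq_trans (card_V_not_winning0 m) _.
exact: ltnW (ltn_expl _ _).
Qed.

Lemma card_V_winning2_ge m : (m <= card_class (V_ m.+3 `&` W_ 2))%N.
Proof.
rewrite winning2E card_V_power_class card_V_winning1.
apply: leq_trans (card_V_not_winning0 m) _.
by apply: leq_trans (ltnW (ltn_expl _ _)) (ltnW (ltn_expl _ _)).
Qed.

(** * Frequencies at a fixed level *)

Lemma freq_ge0 A m : 0 <= freq A m.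
Proof. by rewrite /Defs.freq divr_ge0. Qed.

Lemma freq_le A B m : A `<=` B -> freq A m <= freq B m.
Proof.
move=> AB; rewrite /Defs.freq ler_wpM2r ?invr_ge0 // ler_nat.
apply: card_class_le; last exact: setSI.
by apply: (sub_V_finite m) => x [].
Qed.

Lemma freqU A B m : A `&` B = set0 -> freq (A `|` B) m = freq A m + freq B m.
Proof.
move=> AB0; rewrite /Defs.freq -mulrDl -natrD -card_classU -?setIUl //.
- by apply: (sub_V_finite m) => x [].
- by apply: (sub_V_finite m) => x [].
- by rewrite setIACA AB0 set0I.
Qed.

(** Index 0 is left out: [V_ 0] is empty, so the frequency there is 0 / 0, which has the value 0. *)
Lemma freqT m : freq setT m.+1 = 1.
Proof.
by rewrite /Defs.freq setTI divff // pnatr_eq0 card_VS expn_eq0.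
Qed.

Lemma freqC A m : freq (~` A) m.+1 = 1 - freq A m.+1.
Proof. by rewrite -(freqT m) -(setUv A) freqU ?setICr // addrC addKr. Qed.

Lemma freqU_le A B m : freq (A `|` B) m <= freq A m + freq B m.
Proof.
have -> : A `|` B = A `|` (B `\` A).
  apply/seteqP; split=> x [Ax|]; [by left| |by left|by case; right].
  by have [Ax|nAx] := pselect (A x); [left|right].
rewrite freqU; first by rewrite lerD2l; apply: freq_le => x [].
by apply/seteqP; split=> x // [Ax [_ nAx]].
Qed.

Lemma freq_power_class B m :
  freq (power_class B) m.+1 = 2 ^- card_class (V_ m `\` B).
Proof.
rewrite /Defs.freq setIC card_V_power_class card_VS.
rewrite (card_classID _ _ B (V_finite m)) expnD natrM !natrX.
by rewrite invfM mulrA divff ?mul1r // expf_neq0.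
Qed.

(** Counts inside [V_ m] do not see the restriction to [V_omega], which contains [V_ m]. *)
Lemma freq_S_omega n m : freq (S_omega mem n) m = freq (S_ n) m.
Proof.
congr ((card_class _)%:R / _); apply/seteqP; split=> x [].
  by move=> [_ Sx] Vx.
by move=> Sx Vx; split=> //; split=> //; exists m.
Qed.

(** A set is outside [W_ 1] iff it omits the empty set, a single condition, whence the exponent 1.
    The level [m.+2] ensures that the empty set is in the level below. *)
Lemma freq_S1 m : freq (S_ 1) m.+2 = 1 / 2.
Proof.
rewrite S1E -[W_ 1]setCK freqC (not_winning_oddE 0) freq_power_class.
rewrite setDE setCK card_V_winning0 expr1 div1r.
by rewrite [X in X - _](splitr 1) div1r addrK.
Qed.

(** Each of the two negligible classes contributes at most [2 ^- m]. The shift by 4 is what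
    [card_V_winning2_ge] requires, plus one for passing to the power class. *)
Lemma freq_not_S1_S3_le m :
  freq (~` (S_ 1 `|` S_ 3)) (m + 4)%N <= geometric 2 2^-1 m.
Proof.
rewrite addn4; apply: le_trans (freq_le _ _ _ not_S1_S3_sub) _.
apply: le_trans (freqU_le _ _ _) _.
rewrite winning2E (not_winning_oddE 1) !freq_power_class.
rewrite [_ `\` ~` _]setDE setCK.
have pow_le k : (m <= k)%N -> 2 ^- k <= 2^-1 ^+ m :> R.
  move=> mk; rewrite exprVn lef_pV2 ?posrE ?exprn_gt0 //.
  by rewrite ler_weXn2l ?ler1n.
rewrite [geometric _ _ _]mulr_natl mulr2n lerD // pow_le //.
- exact: leq_trans (leqnSn _) (card_V_not_winning1_ge _).
- exact: card_V_winning2_ge.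
Qed.

(** * Limits of the frequencies *)

Lemma freq_not_S1_S3_cvg : freq (~` (S_ 1 `|` S_ 3)) @ \oo --> (0 : R).
Proof.
rewrite -(cvg_shiftn 4).
have half_lt1 : `|2^-1| < 1 :> R.
  by rewrite ger0_norm ?invr_ge0 // invf_lt1 ?ltr1n.
apply: (squeeze_cvgr _ (cvg_cst 0) (cvg_geometric 2 half_lt1)).
near=> m; apply/andP; split; [exact: freq_ge0|exact: freq_not_S1_S3_le].
Unshelve. all: by end_near.
Qed.

Lemma freq_S1_cvg : freq (S_ 1) @ \oo --> (1 / 2 : R).
Proof.
rewrite -(cvg_shiftn 2); apply: cvg_near_cst.
by near=> m; rewrite /= addn2 freq_S1.
Unshelve. all: by end_near.
Qed.

Lemma freq_S3_cvg : freq (S_ 3) @ \oo --> (1 / 2 : R).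
Proof.
(* [S_ 1], [S_ 3] and the complement of their union partition the universe. *)
have E m : freq (S_ 3) m.+1 =
    1 - freq (S_ 1) m.+1 - freq (~` (S_ 1 `|` S_ 3)) m.+1.
  rewrite freqC freqU ?S_disjoint // opprB.
  by rewrite addrC addrA subrK addrAC subrr add0r.
rewrite -cvg_shiftS; under eq_fun do rewrite E.
have -> : 1 / 2 = 1 - 1 / 2 - 0 :> R.
  by rewrite subr0 [X in X - _](splitr 1) addrK.
apply: cvgB; [apply: cvgB; first exact: cvg_cst|].
- by have := freq_S1_cvg; rewrite -cvg_shiftS.
- by have := freq_not_S1_S3_cvg; rewrite -cvg_shiftS.
Qed.

(** Being disjoint from [S_ 1] and [S_ 3], the class is squeezed below the negligible complement of
    their union. *)
Lemma freq_S_other_cvg n : n <> 1%N -> n <> 3%N ->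
  freq (S_ n) @ \oo --> (0 : R).
Proof.
move=> n1 n3; apply: (squeeze_cvgr _ (cvg_cst 0) freq_not_S1_S3_cvg).
near=> m; rewrite freq_ge0 freq_le // => x Snx [] Sx.
- by have : (S_ n `&` S_ 1) x by []; rewrite S_disjoint.
- by have : (S_ n `&` S_ 3) x by []; rewrite S_disjoint.
Unshelve. all: by end_near.
Qed.

End Winning.

Theorem theorem2 (R : realType) (U : Type) (mem : U -> U -> Prop)
    (zf : ZF_minus mem) :
  (forall n : nat, cvgn (freq mem R (S_omega mem n))) /\
  Pr mem R (S_omega mem 1%N) = 1 / 2 /\
  Pr mem R (S_omega mem 3%N) = 1 / 2 /\
  (forall n : nat, n <> 1%N -> n <> 3%N -> Pr mem R (S_omega mem n) = 0).
Proof.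
have E n : freq mem R (S_omega mem n) = freq mem R (S_ mem n).
  by apply/funext => m; exact: freq_S_omega.
split; [|split; [|split]] => [n|||n n1 n3]; rewrite /Pr ?E.
- have [->|n1] := pselect (n = 1%N).
    by apply/cvg_ex; exists (1 / 2); exact: freq_S1_cvg.
  have [->|n3] := pselect (n = 3%N).
    by apply/cvg_ex; exists (1 / 2); exact: freq_S3_cvg.
  by apply/cvg_ex; exists 0; exact: freq_S_other_cvg.
- by apply/cvg_lim => //; exact: freq_S1_cvg.
- by apply/cvg_lim => //; exact: freq_S3_cvg.
- by apply/cvg_lim => //; exact: freq_S_other_cvg.
Qed.
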